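(* Let $(X,\tau)$ be a Hausdorff topological space. Let $S:X\rightrightarrows X$ be a set-valued map and suppose: (1) $S$ is lower semicontinuous at each point of $\operatorname{dom} S$; (2) for every open cover $\gamma$ of $X$ there exist $x\in X$ and $U\in\gamma$ such that $S(x)\subseteq U$ and $x\in U$. Then there exists a point $\bar{x}\in X$ such that $S(\bar{x})\subseteq\{\bar{x}\}$.
   Context: A set-valued map $S:X\rightrightarrows X$ assigns to each $x\in X$ a (possibly empty) subset $S(x)\subseteq X$; $\operatorname{dom} S:=\{x\in X: S(x)\neq\emptyset\}$. $S$ is lower semicontinuous at $x\in\operatorname{dom} S$ if for every open $V\subseteq X$ with $S(x)\cap V\ne\emptyset$ there is an open neighborhood $U\subseteq X$ of $x$ such that $S(x')\cap V\neq\emptyset$ for all $x'\in U$. *)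

(* Defs.v *)
From mathcomp Require Import all_boot.
From mathcomp Require Import boolp classical_sets topology.

Set Implicit Arguments.
Unset Strict Implicit.
Unset Printing Implicit Defensive.

Local Open Scope classical_set_scope.

Definition set_valued_dom (X : Type) (S : X -> set X) : set X :=
  [set x | S x !=set0].

Definition set_valued_lsc_at (X : topologicalType) (S : X -> set X) (x : X) :
    Prop :=
  forall V : set X, open V -> S x `&` V !=set0 ->
    exists2 U : set X, open_nbhs x U &
      forall x', U x' -> S x' `&` V !=set0.

Definition open_cover_of_space (X : topologicalType) (gamma : set (set X)) :
    Prop :=
  gamma `<=` open /\ \bigcup_(U in gamma) U = setT.

(* Main.v *)
Require Import Defs.
From mathcomp Require Import all_boot.
From mathcomp Require Import boolp classical_sets topology.

Set Implicit Arguments.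
Unset Strict Implicit.
Unset Printing Implicit Defensive.

Local Open Scope classical_set_scope.

(** If no such point existed, every [x] would have some [y] in [S x] distinct
    from [x].  Separating [x] from [y] by disjoint open sets [A] and [B], lower
    semicontinuity makes [S x'] meet [B] for all [x'] near [x], so a small open
    neighbourhood [W] of [x] inside [A] contains [S x'] for none of its points
    [x'].  These [W] form an open cover contradicting (2). *)

Theorem theorem2p8 (X : topologicalType) (hX : hausdorff_space X)
    (S : X -> set X)
    (hlsc : forall x : X, set_valued_dom S x -> set_valued_lsc_at S x)
    (hcover : forall gamma : set (set X), open_cover_of_space gamma ->
       exists (x : X) (U : set X), [/\ gamma U, S x `<=` U & U x]) :
  exists xbar : X, S xbar `<=` [set xbar].
Proof.
apply: contrapT => noxbar.
(* Collecting every open set that violates the conclusion of (2), instead of choosing one [W] per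
   point, leaves only the covering property to prove. *)
pose gamma := [set W : set X | open W /\ forall x, W x -> ~ S x `<=` W].
suff cover_gamma : open_cover_of_space gamma.
  by have [x [W [[_ WS] SxW Wx]]] := hcover _ cover_gamma; exact: WS SxW.
split=> [W []//|]; rewrite -subTset => x _.
have [y Sxy yx] : exists2 y, S x y & y <> x.
  apply: contrapT => noy; apply: noxbar; exists x => y Sxy.
  by apply: contrapT => yx; apply: noy; exists y.
have xy : x != y by apply/eqP => /esym.
move: hX; rewrite open_hausdorff => /(_ _ _ xy)[[A B] /= [xA yB] [oA oB /eqP AB0]].
(* The point [y] serves twice: it puts [x] in the domain of [S] and shows that [S x] meets [B]. *)
have [||U [oU Ux] US] := @hlsc x _ B oB.
- by exists y.
- by exists y; split=> //; exact: set_mem.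
exists (U `&` A); last by split=> //; exact: set_mem.
split=> [|x' [Ux' _] SUA]; first exact: openI.
(* A point [z] of [S x'] in [B] would also lie in [A] by [SUA], against disjointness. *)
have [z [Sz Bz]] := US _ Ux'.
suff : set0 z by [].
by rewrite -AB0; split=> //; have [] := SUA _ Sz.
Qed.
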